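(* Let $r\ge 3$ and $k\ge 1$ be integers. Every linear $r$-uniform hypergraph $\mathcal{H}$ with average degree at least $7r(k+1)$ contains Berge cycles of $k$ consecutive lengths.
   Context: All hypergraphs are finite, simple (no repeated edges) and have a non-empty vertex set. An $r$-uniform hypergraph is one all of whose edges have exactly $r$ vertices. A hypergraph is linear if any two distinct edges share at most one vertex. The degree of a vertex is the number of edges containing it; the average degree is the average of the degrees over all vertices, i.e. $r|\mathcal{E}(\mathcal{H})|/|\mathcal{V}(\mathcal{H})|$. A Berge cycle of length $\ell$ ($\ell\ge 3$) is a hypergraph consisting of $\ell$ distinct edges $e_1,\dots,e_\ell$ for which there exist $\ell$ distinct vertices $v_1,\dots,v_\ell$ with $v_i,v_{i+1}\in e_i$ for $1\le i\le \ell-1$ and $v_1,v_\ell\in e_\ell$. ''$\mathcal{H}$ contains Berge cycles of $k$ consecutive lengths'' means that there is an integer $a$ such that, for every $\ell\in\{a,a+1,\dots,a+k-1\}$, $\mathcal{H}$ contains a Berge cycle of length $\ell$ as a subhypergraph. *)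

(* Defs.v *)
(* MathComp.  A finite simple hypergraph with vertex set V is its set of edges
   H : {set {set V}}; non-emptiness of V is a separate hypothesis. *)
From mathcomp Require Import all_boot all_order all_algebra.
Set Implicit Arguments.
Unset Strict Implicit.
Unset Printing Implicit Defensive.
Import GRing.Theory Num.Theory.

Section Hypergraph.

Variable V : finType.
Implicit Types (H C : {set {set V}}) (v : V).

Definition uniform (r : nat) H : Prop := forall e, e \in H -> #|e| = r.

Definition linear_hypergraph H : Prop :=
  forall e f, e \in H -> f \in H -> e != f -> #|e :&: f| <= 1.

Definition degree H v : nat := #|[set e in H | v \in e]|.

Definition avg_degree H : rat := ((\sum_(v : V) degree H v)%:R / #|V|%:R)%R.

(* ordS is the cyclic successor on 'I_l, so the last edge contains both the
   last and the first of the vertices. *)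
Definition berge_cycle (l : nat) C : Prop :=
  3 <= l /\
  exists (e : 'I_l -> {set V}) (v : 'I_l -> V),
    [/\ injective e, injective v, C = [set e i | i : 'I_l]
      & forall i : 'I_l, v i \in e i /\ v (ordS i) \in e i].

Definition contains_berge_cycle (l : nat) H : Prop :=
  exists C, C \subset H /\ berge_cycle l C.

Definition berge_cycles_consecutive (k : nat) H : Prop :=
  exists a : nat, forall l, a <= l < a + k -> contains_berge_cycle l H.

End Hypergraph.

(* Main.v *)
Require Import Defs.
From mathcomp Require Import all_boot all_order all_algebra.
From mathcomp Require Import zify.
Set Implicit Arguments.
Unset Strict Implicit.
Unset Printing Implicit Defensive.

(** Why the theorem holds. An average degree of at least 7r(k+1) means at least
7(k+1) edges per vertex. Explore H by breadth-first search, one root in each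
component. The vertices of an edge lie on one or two consecutive levels; call
a vertex of the edge on its lower level its apex. Each vertex is counted in
at most two pairs of consecutive levels, so some pair, i and i+1, carries more
than 2(k+1) edges with apex on level i for each of its vertices
([bfs_dense_level]).

Colour two vertices of level i by the branch of the search tree in which they
lie, seen from the lowest node of that tree below all of them; here both
vertices and edges count as nodes. Then any two vertices of different colours
are joined by a Berge path of one fixed length d that runs below level i
([bichromatic_below_paths]). It therefore suffices to find, using only edges
with apex on level i, Berge paths of k consecutive lengths between vertices of
level i that have different colours.

To find them, give every edge with apex on level i the colour of its apex and
remove the apex from it. A minimal set W of vertices that spans more than
2(k+1)|W| of these reduced edges has minimum degree above 2(k+1) and is
connected ([minimal_dense_set]). Connectedness gives a vertex u of W in edges
of both colours. Linearity allows a Berge path with m < k edges to be built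
greedily from u inside W, to end at some w ([greedy_berge_path]). Both u and w
lie in many edges of some colour. If it is the same colour for both, start at
u with a single edge of the other colour, kept away from the path in advance;
otherwise use the majority colours of u and of w. In both cases the path
extends by one edge at each end to two apexes of different colours, and the
path of length d below level i closes it to a Berge cycle of length m + 2 + d
([dense_level_berge_cycles]). Now let m run through 0, ..., k - 1. *)

(** * Berge paths as sequences of steps *)

Section Walks.
Variable V : finType.
Implicit Types (H F : {set {set V}}) (e : {set V}) (u v w : V).
Implicit Types (a b : {set V} * V) (p q : seq ({set V} * V)).

(** A step of a walk is a pair (edge, vertex reached by it); [hop a b] says that
the edge of [b] leads from the vertex of [a] to that of [b]. *)
Definition hop a b := (a.2 \in b.1) && (b.2 \in b.1).

(** [p] is the sequence of steps made from [u]. The edge of the initial pair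
[(set0, u)] is a dummy: [hop] ignores the edge of its first argument. *)
Definition berge_path H u p :=
  [/\ path hop (set0, u) p, uniq (map fst p), uniq (u :: map snd p)
    & {subset map fst p <= H}].

Lemma path_hop_start e e' u p : path hop (e, u) p = path hop (e', u) p.
Proof. by case: p. Qed.

Lemma last_step e u p : (last (e, u) p).2 = last u (map snd p).
Proof. by elim: p e u => //= -[f v] p IHp. Qed.

(** This is how edges are shown to be off a path: an edge at [w] that meets the
path in no vertex other than [w] is not an edge of the path. *)
Lemma berge_path_edge H u p w e : berge_path H u p -> e \in map fst p ->
  exists x, [/\ x \in e, x \in u :: map snd p & x != w].
Proof.
case=> + _ + _.
elim: p u => [|[f y] p IHp] u //= /andP[/andP[/= ue ye] Hp] /andP[unot uy].
rewrite inE => /orP[/eqP->|ep].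
  have [Ew|Nw] := eqVneq u w; last by exists u; rewrite mem_head.
  exists y; split=> //; first by rewrite !inE eqxx orbT.
  by rewrite -Ew; apply: contraNneq unot => ->; rewrite mem_head.
have Hp' : path hop (set0, y) p by rewrite (path_hop_start _ f).
have [x [xe xp xw]] := IHp y Hp' uy ep.
by exists x; split=> //; rewrite inE xp orbT.
Qed.

Lemma contains_closed_walk H p : 3 <= size p -> cycle hop p ->
  uniq (map fst p) -> uniq (map snd p) -> {subset map fst p <= H} ->
  contains_berge_cycle (size p) H.
Proof.
case: p => [|x p'] //; set p := x :: p' => s3 cyc uf us sub.
have step (i : 'I_(size p)) : hop (nth x p i) (nth x p (ordS i)).
  have /(pathP x)/(_ i) : path hop x (rcons p' x) by [].
  rewrite size_rcons => /(_ (ltn_ord i)).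
  rewrite -rcons_cons nth_rcons ltn_ord nth_rcons /=.
  have := ltn_ord i; rewrite [X in _ < X]/= ltnS leq_eqVlt => /orP[/eqP Ei|li].
    by rewrite Ei ltnn eqxx modnn.
  by rewrite li modn_small.
(* The i-th edge of a Berge cycle leaves the i-th vertex, whereas the i-th step
   stores the edge that reaches it: hence the shift by one. *)
exists [set (nth x p (ordS i)).1 | i : 'I_(size p)]; split.
  apply/subsetP=> _ /imsetP[i _ ->]; apply: sub.
  by apply: map_f; apply: mem_nth; exact: ltn_ord.
split=> //; exists (fun i => (nth x p (ordS i)).1), (fun i => (nth x p i).2).
split=> //.
- move=> i j; rewrite -!(nth_map _ set0) ?ltn_ord // => /eqP.
  by rewrite nth_uniq ?size_map ?ltn_ord // => /eqP/val_inj/ordS_inj.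
- move=> i j; rewrite -!(nth_map _ x.2) ?ltn_ord // => /eqP.
  by rewrite nth_uniq ?size_map ?ltn_ord // => /eqP/val_inj.
- by move=> i; have /andP := step i.
Qed.

End Walks.

(** * Greedy paths in linear hypergraphs *)

Section Linear.
Variable V : finType.
Implicit Types (H F D : {set {set V}}) (e : {set V}) (u v w : V).

Lemma linear_edge_eq F e f x y : linear_hypergraph F -> e \in F -> f \in F ->
  x \in e -> y \in e -> x \in f -> y \in f -> x != y -> e = f.
Proof.
move=> lin eF fF xe ye xf yf xy; apply/eqP/negPn/negP=> /(lin _ _ eF fF).
rewrite leqNgt => /negP[]; apply/card_gt1P; exists x, y.
by rewrite !inE xe ye xf yf.
Qed.

(** In a linear hypergraph, a vertex of [X] lies in at most one edge with [w],
so at most [#|X|] of the edges at [w] meet [X]. *)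
Lemma exists_edge_avoiding F D (X : {set V}) w : linear_hypergraph F ->
  D \subset F -> {in D, forall e, w \in e} -> w \notin X -> #|X| < #|D| ->
  exists2 e, e \in D & [disjoint e & X].
Proof.
move=> lin /subsetP DF wD wX ltXD; apply/exists_inP.
apply: contraLR ltXD => /exists_inPn meet; rewrite -leqNgt.
pose h e := odflt w [pick x in e :&: X].
have hP e : e \in D -> h e \in e :&: X.
  rewrite /h => /meet/pred0Pn[x /= /andP[xe xX]].
  by case: pickP => [//|/(_ x)]; rewrite inE xe [x \in X]xX.
rewrite -(card_in_imset (f := h)); last first.
  move=> e f eD fD Eh; have := hP f fD; have := hP e eD; rewrite -Eh !inE.
  move=> /andP[he hX] /andP[hf _].
  apply: (linear_edge_eq lin (DF _ eD) (DF _ fD) he (wD e eD) hf (wD f fD)).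
  by apply: contraNneq wX => <-.
apply/subset_leq_card/subsetP=> _ /imsetP[e /hP + ->].
by rewrite inE => /andP[].
Qed.

(** The path is confined to the sets [g e], in which degrees are large, but it
has to avoid the whole edges [e]: the last vertex [w] of a path with [m] edges
is left through an edge that avoids [f], [z] and the [m] other vertices of the
path. The edge [f] and the vertex [z] are kept free for the closing of a
cycle. *)
Lemma greedy_berge_path F (g : {set V} -> {set V}) (W : {set V}) n
    (lin : linear_hypergraph F)
    (gsub : {in F, forall e, g e \subset e})
    (gW : {in F, forall e, g e \subset W})
    (g_gt1 : {in F, forall e, 1 < #|g e|})
    (deg : {in W, forall t, n.+1 < #|[set e in F | t \in g e]|})
    (u z : V) (f : {set V}) (uW : u \in W) (uz : u != z) m :
  m <= n -> exists p, [/\ size p = m, berge_path F u p,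
    {subset u :: map snd p <= W}, f \notin map fst p & z \notin map snd p].
Proof.
elim: m => [|m IHm] ltmn.
  exists [::]; split=> //=.
  by move=> x; rewrite mem_seq1 => /eqP->.
have [p [sz bp sub fp zp]] := IHm (ltnW ltmn).
pose w := last u (map snd p); pose P := u :: map snd p.
have wP : w \in P by exact: mem_last.
have wW : w \in W by exact: sub.
pose D := [set e in F | w \in g e] :\ f.
pose X := [set x in P] :\ w :|: [set z].
have zP : z \notin P by rewrite inE negb_or eq_sym uz.
have cX : #|X| < #|D|.
  have cP : #|[set x in P] :\ w| = m.
    case: bp => _ _ /card_uniqP cP _; move: (cardsD1 w [set x in P]).
    by rewrite inE wP cardsE cP /= size_map sz => -[].
  have := leq_of_leqif (leq_card_setU ([set x in P] :\ w) [set z]).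
  rewrite cP cards1 => /leq_ltn_trans; apply.
  rewrite -(ltn_add2l (f \in [set e in F | w \in g e])) -cardsD1.
  by apply: leq_ltn_trans (deg _ wW); case: (f \in _); lia.
have wX : w \notin X by rewrite !inE eqxx /=; apply: contraNneq zP => <-.
have DF : D \subset F by apply/subsetP=> e; rewrite !inE => /and3P[].
have wD : {in D, forall e, w \in e}.
  by move=> e; rewrite !inE => /and3P[_ eF] /(subsetP (gsub _ eF)).
have [e] := exists_edge_avoiding lin DF wD wX cX.
rewrite !inE => /and3P[ef eF wge] eX.
have /card_gt1P[y1 [y2 [y1e y2e y12]]] := g_gt1 _ eF.
have [y yge yw] : exists2 y, y \in g e & y != w.
  have [E|] := eqVneq y1 w; last by exists y1.
  by exists y2 => //; rewrite -E eq_sym.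
have we : w \in e := subsetP (gsub _ eF) _ wge.
have ye : y \in e := subsetP (gsub _ eF) _ yge.
have yX : y \notin X by rewrite (disjointFr eX).
have yz : y != z by apply: contraNneq yX => ->; rewrite !inE eqxx orbT.
have yP : y \notin P.
  by apply: contra yX => yP; rewrite in_setU in_setD1 yw inE yP.
have ep : e \notin map fst p.
  apply/negP=> /(berge_path_edge w bp)[x [xe xP xw]].
  by have := disjointFr eX xe; rewrite in_setU in_setD1 xw inE xP.
exists (rcons p (e, y)); rewrite size_rcons sz !map_rcons /=.
case: bp => hp ue uv su; split=> //.
- split.
  + by rewrite rcons_path hp /hop last_step we ye.
  + by rewrite map_rcons rcons_uniq ep.
  + by rewrite map_rcons -rcons_cons rcons_uniq yP.
  + by move=> e'; rewrite map_rcons mem_rcons inE => /orP[/eqP->|/su].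
- move=> x; rewrite -rcons_cons mem_rcons inE => /orP[/eqP->|/sub//].
  exact: subsetP (gW _ eF) _ yge.
- by rewrite mem_rcons inE negb_or fp eq_sym ef.
- by rewrite mem_rcons inE negb_or zp eq_sym yz.
Qed.

End Linear.

(** * Minimal dense vertex sets *)

Section Dense.
Variables (V T : finType).

Definition inside (E : {set T}) (g : T -> {set V}) (W : {set V}) :=
  [set e in E | g e \subset W].

(** Take [W] minimal with more than [c * #|W|] edges inside. Deleting a vertex of
degree at most [c] would leave a smaller such set, and if [W] were the disjoint
union of two nonempty parts without an edge across, one of the parts would be
such a set. Connectedness is stated as: every predicate that is constant on
edges is constant. *)
Lemma minimal_dense_set (E : {set T}) (g : T -> {set V}) (W0 : {set V}) c :
  c * #|W0| < #|inside E g W0| ->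
  exists W : {set V}, let F := inside E g W in [/\ exists e, e \in F,
    {in W, forall t, c < #|[set e in F | t \in g e]|}
  & forall P : pred V, {in F, forall e, {in g e &, forall x y, P x = P y}} ->
      {in W &, forall x y, P x = P y}].
Proof.
pose dense (W : {set V}) := c * #|W| < #|inside E g W|.
move=> dW0; have [W /minsetP[dW minW]] : {W | minset dense W}.
  by apply: ex_minset; exists W0.
have sparse (U : {set V}) : U \proper W -> #|inside E g U| <= c * #|U|.
  rewrite properEneq leqNgt => /andP[neUW sUW]; apply: contraNN neUW => dU.
  by rewrite (minW U).
exists W; split.
- by apply/card_gt0P/(leq_ltn_trans _ dW).
- move=> t tW; have := sparse _ (properD1 tW).
  have -> : inside E g (W :\ t) =
      inside E g W :\: [set e in inside E g W | t \in g e].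
    apply/setP=> e; rewrite !inE subsetD1.
    by case: (e \in E); case: (_ \subset _); case: (t \in _).
  rewrite cardsD (setIidPr _); last by apply/subsetP=> e; rewrite inE => /andP[].
  by move: dW; rewrite /dense (cardsD1 t W) tW; lia.
- move=> P constP x y xW yW; apply/eqP; apply: contraLR (dW) => Pxy.
  pose Q := [set z | P z == P x].
  have UQ : inside E g W \subset inside E g (W :&: Q) :|: inside E g (W :\: Q).
    apply/subsetP=> e eF; move: (eF); rewrite !inE => /andP[-> gW] /=.
    rewrite !subsetI subsetD gW /=.
    have [->|[z ze]] := set_0Vmem (g e); first by rewrite sub0set.
    have [Pz|Pz] := boolP (P z == P x); apply/orP; [left|right].
      by apply/subsetP=> z' z'e; rewrite inE (constP e eF z' z).
    rewrite disjoint_subset; apply/subsetP=> z' z'e.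
    by rewrite !inE (constP e eF z' z).
  rewrite /dense -leqNgt (leq_trans (subset_leq_card UQ)) //.
  rewrite (leq_trans (leq_of_leqif (leq_card_setU _ _))) //.
  rewrite -(cardsID Q W) mulnDr leq_add //.
    apply/sparse/properP; split; first exact: subsetIl.
    by exists y => //; rewrite !inE yW eq_sym.
  apply/sparse/properP; split; first exact: subsetDl.
  by exists x => //; rewrite !inE xW eqxx.
Qed.
End Dense.

(** * Breadth-first search *)

Section Levels.
Variable V : finType.
Implicit Types (H : {set {set V}}).

(** The outcome of a breadth-first search with one root in each component:
[comp v] is the root of the component of [v], [lev v] the distance from it,
[apex e] a vertex of [e] closest to the root, and [up v] an edge that leads
from [v] one level down. As the parent [apex (up v)] depends only on the edge
[up v], vertices and edges form a tree. *)
Record bfs_layering H (comp : V -> V) (lev : V -> nat)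
    (apex : {set V} -> V) (up : V -> {set V}) : Prop := BfsLayering {
  comp_edge : forall e u v, e \in H -> u \in e -> v \in e -> comp u = comp v;
  comp_root : forall v, lev v = 0 -> comp v = v;
  lev_edge : forall e u v, e \in H -> u \in e -> v \in e -> lev v <= (lev u).+1;
  apex_in : forall e, e \in H -> apex e \in e;
  apex_min : forall e v, e \in H -> v \in e -> lev (apex e) <= lev v;
  up_edge : forall v, 0 < lev v ->
    [/\ up v \in H, v \in up v & lev (apex (up v)) < lev v]
}.

(** [x0] serves as the apex of the empty set, which is not an edge. *)
Lemma bfs_layering_exists H (x0 : V) : (forall e, e \in H -> e != set0) ->
  exists comp lev apex up, bfs_layering H comp lev apex up.
Proof.
move=> H0.
pose adj : rel V := fun u v => [exists e in H, (u \in e) && (v \in e)].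
have adjP e u v : e \in H -> u \in e -> v \in e -> adj u v.
  by move=> eH ue ve; apply/exists_inP; exists e; rewrite ?ue.
have adjC : symmetric adj.
  by move=> u v; apply: eq_existsb => e; rewrite [(u \in e) && _]andbC.
have cadjC := sym_connect_sym adjC.
pose rt := fingraph.root adj.
pose at_dist (v : V) n :=
  [exists p : n.-tuple V, path adj (rt v) p && (last (rt v) p == v)].
have distP v p : path adj (rt v) p -> last (rt v) p = v ->
  at_dist v (size p).
  by move=> hp lp; apply/existsP; exists (in_tuple p); rewrite hp lp /=.
have has_dist v : exists n, at_dist v n.
  have : connect adj (rt v) v by rewrite cadjC fingraph.connect_root.
  by case/connectP=> p hp lp; exists (size p); apply: distP.
pose lev v := ex_minn (has_dist v).
have levP v : exists p, [/\ path adj (rt v) p, last (rt v) p = v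
   & size p = lev v].
  rewrite /lev; case: ex_minnP => n /existsP[p /andP[hp /eqP lp]] _.
  by exists p; rewrite size_tuple.
have lev_min v p : path adj (rt v) p -> last (rt v) p = v ->
    lev v <= size p.
  by rewrite /lev; case: ex_minnP => n _ nmin hp lp; apply/nmin/distP.
have root_adj u v : adj u v -> rt u = rt v.
  by move=> uv; apply/(fingraph.rootP cadjC)/connect1.
have lev_adj u v : adj u v -> lev v <= (lev u).+1.
  move=> uv; have [p [hp lp <-]] := levP u; rewrite -(size_rcons p v).
  by apply: lev_min; rewrite -(root_adj u v uv) ?last_rcons // rcons_path hp lp.
have apexP e : exists a, e \in H ->
    a \in e /\ forall v, v \in e -> lev a <= lev v.
  have [E|[x xe]] := set_0Vmem e.
    by exists x0 => /H0; rewrite E eqxx.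
  by exists [arg min_(a < x in e) lev a] => _; case: arg_minnP.
have upP v : exists e, 0 < lev v ->
    [/\ e \in H, v \in e & exists2 u, u \in e & lev u < lev v].
  have [p [hp lp sp]] := levP v.
  case/lastP: p hp lp sp => [|p y]; first by move=> _ _ <-; exists set0.
  rewrite rcons_path last_rcons size_rcons => /andP[hp yv] Ey sp.
  rewrite {y}Ey in yv; have /exists_inP[e eH /andP[ue ve]] := yv.
  exists e => _; split=> //; exists (last (rt v) p) => //.
  by rewrite -sp ltnS lev_min // (root_adj _ _ yv).
have [up upE] := fin_all_exists upP.
have [apex apexE] := fin_all_exists apexP.
exists rt, lev, apex, up; split.
- by move=> e u v eH ue ve; apply/root_adj/adjP; eassumption.
- move=> v lv; have [p [_ + ]] := levP v; rewrite lv.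
  by move=> + /size0nil => /[swap] ->.
- by move=> e u v eH ue ve; apply/lev_adj/adjP; eassumption.
- by move=> e /apexE[].
- by move=> e v /apexE[_]; apply.
- move=> v /upE[eH ve [u ue uv]]; split=> //.
  have [_ amin] := apexE _ eH; exact: leq_ltn_trans (amin _ ue) uv.
Qed.


Lemma sum_card_fibers (T : finType) (A : {set T}) (f : T -> nat) n :
  (forall t, f t < n) -> \sum_(i < n) #|[set t in A | f t == i]| = #|A|.
Proof.
move=> fn; rewrite -sum1_card (partition_big (fun t => Ordinal (fn t)) predT) //.
by apply: eq_bigr => i _; rewrite -sum1dep_card.
Qed.

(** Otherwise adding up over all levels would bound [#|H|] by [c] times
[2 * #|V|], since each vertex lies in two unions of consecutive levels. *)
Lemma bfs_dense_level H comp lev apex up c :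
  bfs_layering H comp lev apex up -> 2 * c * #|V| < #|H| ->
  exists i : nat, c * #|[set v | (lev v == i) || (lev v == i.+1)]|
            < #|[set e in H | lev (apex e) == i]|.
Proof.
move=> layers dense.
pose n := (\max_v lev v).+1.
have levn v : lev v < n by rewrite ltnS leq_bigmax.
pose L (i : nat) := [set v in [set: V] | lev v == i].
have sumL : \sum_(i < n) #|L i| = #|V| by rewrite sum_card_fibers ?cardsT.
have sumL1 : \sum_(i < n) #|L i.+1| <= #|V|.
  rewrite -[X in _ <= X]cardsT -(sum_card_fibers setT (fun v => leqW (levn v))).
  by rewrite big_ord_recl leq_addl.
suff /existsP[i iP] : [exists i : 'I_n,
    c * #|[set v | (lev v == i) || (lev v == i.+1)]|
      < #|[set e in H | lev (apex e) == i]|] by exists i.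
apply: contraLR dense => /existsPn sparse; rewrite -leqNgt.
rewrite -(sum_card_fibers H (fun e => levn (apex e))).
apply: (@leq_trans (\sum_(i < n) c * (#|L i| + #|L i.+1|))).
  apply: leq_sum => i _; move: (sparse i); rewrite -leqNgt => /leq_trans; apply.
  rewrite leq_mul2l; apply/orP; right.
  have <- : L i :|: L i.+1 = [set v | (lev v == i) || (lev v == i.+1)].
    by apply/setP=> v; rewrite !inE.
  exact: leq_of_leqif (leq_card_setU _ _).
rewrite -big_distrr /= big_split /= sumL [2 * c]mulnC -mulnA leq_mul2l mul2n.
by rewrite -addnn leq_add2l sumL1 orbT.
Qed.

(** [q] is a Berge path from [a] to [b] whose edges have their apex below level
[i] and whose inner vertices are below level [i]; hence it cannot collide with
a path made of edges with apex on level [i]. *)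
Definition below_path H (comp : V -> V) lev (apex : {set V} -> V) i a b q :=
  [/\ berge_path H a q, last a (map snd q) = b,
      {in map fst q, forall e, lev (apex e) < i}
    & {in map snd q, forall v, (lev v < i) || (v == b)}].

Lemma apex_up_lev H comp lev apex up v i :
  bfs_layering H comp lev apex up -> lev v = i.+1 ->
  [/\ up v \in H, v \in up v & lev (apex (up v)) = i].
Proof.
move=> layers lv; have [|uH vu] := up_edge layers (v := v); first by rewrite lv.
rewrite lv ltnS => lei; split=> //; apply/eqP; rewrite eqn_leq lei /=.
by have := lev_edge layers uH (apex_in layers uH) vu; rewrite lv ltnS.
Qed.

Lemma below_path_extend H comp lev apex up i a b q :
  bfs_layering H comp lev apex up -> lev a = i.+1 -> lev b = i.+1 ->
  let pa := apex (up a) in let pb := apex (up b) in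
  up a != up b -> below_path H comp lev apex i pa pb q ->
  below_path H comp lev apex i.+1 a b ((up a, pa) :: rcons q (up b, b)).
Proof.
move=> layers la lb pa pb neq [[hq ue uv sH] lq qe qv].
have [aH aa lpa] := apex_up_lev layers la.
have [bH bb lpb] := apex_up_lev layers lb.
have paa := apex_in layers aH; have pbb := apex_in layers bH.
have qle v : v \in pa :: map snd q -> lev v <= i.
  rewrite inE => /orP[/eqP->|/qv/orP[/ltnW//|/eqP->]]; first by rewrite lpa.
  by rewrite lpb.
have ge_notin v : lev v = i.+1 -> v \notin pa :: map snd q.
  by move=> lv; apply/negP=> /qle; rewrite lv ltnn.
have up_notin v : lev v = i.+1 -> up v \notin map fst q.
  by move=> /(apex_up_lev layers)[_ _ lpv]; apply/negP=> /qe; rewrite lpv ltnn.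
split.
- split.
  + rewrite /= rcons_path {1}/hop /= aa paa (path_hop_start _ set0) hq /=.
    by rewrite /hop last_step lq pbb bb.
  + by rewrite /= map_rcons rcons_uniq mem_rcons inE negb_or neq !up_notin.
  + rewrite [map _ _]/= map_rcons -[pa :: _]/(rcons (pa :: map snd q) b).
    rewrite cons_uniq rcons_uniq mem_rcons in_cons negb_or !ge_notin // uv.
    by rewrite !andbT; apply: contraNneq neq => ->.
  + move=> e; rewrite /= map_rcons inE mem_rcons inE.
    by case/or3P=> [/eqP->|/eqP->|/sH].
- by rewrite /= map_rcons last_rcons.
- move=> e; rewrite /= map_rcons inE mem_rcons inE.
  by case/or3P=> [/eqP->|/eqP->|/qe/ltnW]; rewrite ?lpa ?lpb.
- move=> v; rewrite /= map_rcons inE mem_rcons inE orbCA ltnS.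
  by move=> /orP[->|vq]; rewrite ?orbT // qle.
Qed.

(** Induction on the level replaces the search for a lowest common ancestor.
Replace the vertices of [S] by their parents. If there is only one edge up to
parents, its vertices are pairwise at distance 1; if there are several edges
but only one parent, two vertices with different edges are at distance 2;
otherwise the colouring of the parents pulls back, and the distance grows
by 2. On level 0 the set [S] has at most one vertex, the root. *)
Lemma bichromatic_below_paths H comp lev apex up i (S : {set V}) :
  bfs_layering H comp lev apex up -> {in S, forall v, lev v = i} ->
  {in S &, forall u v, comp u = comp v} -> 1 < #|S| ->
  exists (chi : V -> bool) (d : nat), [/\ 0 < d,
    exists a b, [/\ a \in S, b \in S & chi a != chi b]
  & {in S &, forall a b, chi a != chi b -> exists2 q, size q = d
      & below_path H comp lev apex i a b q}].
Proof.
move=> layers; elim: i S => [|i IHi] S levS compS /card_gt1P[x [y [xS yS xy]]].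
  have := compS x y xS yS; rewrite !(comp_root layers) ?levS //.
  by move/eqP; rewrite (negPf xy).
have lup v : v \in S -> [/\ up v \in H, v \in up v & lev (apex (up v)) = i].
  by move=> /levS; apply: apex_up_lev layers.
have [/existsP[[a b] /and3P[/= aS bS neq]]|/existsPn same_up] :=
    boolP [exists ab, [&& ab.1 \in S, ab.2 \in S & up ab.1 != up ab.2]]; last first.
  have up_x v : v \in S -> up v = up x.
    by move=> vS; apply/eqP; move: (same_up (v, x)); rewrite vS xS negbK.
  exists (pred1 x), 1; split=> //.
    by exists x, y; rewrite /= eqxx [y == x]eq_sym (negPf xy).
  move=> a b aS bS /= ab; have [aH aa la] := lup a aS; have [_ bb _] := lup b bS.
  exists [:: (up a, b)] => //; split=> //.
  - split=> //=; last by move=> e; rewrite inE => /eqP->.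
    + by rewrite /hop /= aa up_x // -(up_x b) // bb.
    + by rewrite inE andbT; apply: contraNneq ab => ->.
  - by move=> e; rewrite /= inE => /eqP->; rewrite la.
  - by move=> v; rewrite /= inE => ->; rewrite orbT.
pose S' := [set apex (up v) | v in S].
have [leS'|gtS'] := leqP #|S'| 1.
  have apex_x v : v \in S -> apex (up v) = apex (up x).
    move=> vS; apply/eqP; move: leS'; rewrite leqNgt; apply: contraNT => ne.
    by apply/card_gt1P; exists (apex (up v)), (apex (up x)); rewrite !imset_f.
  exists (fun v => up v == up a), 2; split=> //.
    by exists a, b; rewrite aS bS eqxx [up b == _]eq_sym (negPf neq).
  move=> c d cS dS cd; have ne : up c != up d by apply: contraNneq cd => ->.
  exists ((up c, apex (up c)) :: rcons [::] (up d, d)) => //.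
  apply: (below_path_extend layers); rewrite ?levS //.
  by rewrite !apex_x.
have [||chi [d [d0 [_ [_ [/imsetP[a' a'S ->] /imsetP[b' b'S ->] ab]]] paths]]] :=
    IHi S' _ _ gtS'.
- by move=> _ /imsetP[v /lup[_ _ lv] ->].
- move=> _ _ /imsetP[u uS ->] /imsetP[v vS ->].
  have [uH uu _] := lup u uS; have [vH vv _] := lup v vS.
  rewrite (comp_edge layers uH (apex_in layers uH) uu).
  by rewrite (comp_edge layers vH (apex_in layers vH) vv); apply: compS.
exists (fun v => chi (apex (up v))), d.+2; split=> //; first by exists a', b'.
move=> c e cS eS ce.
have [q sq bq] := paths _ _ (imset_f _ cS) (imset_f _ eS) ce.
exists ((up c, apex (up c)) :: rcons q (up e, e)).
  by rewrite /= size_rcons sq.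
apply: (below_path_extend layers); rewrite ?levS //.
by apply: contraNneq ce => ->.
Qed.
End Levels.

(** * Cycles through a dense level *)

Section Main.
Variable V : finType.
Implicit Types (H F : {set {set V}}) (e : {set V}).

(** The edges of [F] all have their apex on level [i], those of [q] below it, and
[q] returns to level [i] only at its ends, the apexes of [e1] and [e2]; so the
two parts of the cycle are disjoint. *)
Lemma close_berge_cycle H F comp lev apex up i u p q e1 e2
    (w := last u (map snd p)) :
  bfs_layering H comp lev apex up -> F \subset H ->
  {in F, forall e, lev (apex e) = i} ->
  berge_path F u p -> e1 \in F -> e2 \in F -> e1 != e2 ->
  u \in e1 -> w \in e2 -> e1 \notin map fst p -> e2 \notin map fst p ->
  apex e1 \notin u :: map snd p -> apex e2 \notin u :: map snd p ->
  0 < size q -> below_path H comp lev apex i (apex e2) (apex e1) q ->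
  contains_berge_cycle (size p + size q + 2) H.
Proof.
move=> layers /subsetP FH levF [hp up_ us sF] e1F e2F e12 ue1 we2 e1p e2p a1p a2p.
move=> q0 [[hq uq vq qH] lq lev_q lvq].
have lowF e x : e \in F -> x \in e -> i <= lev x.
  by move=> eF xe; rewrite -(levF e eF); exact: (apex_min layers (FH _ eF) xe).
have lowp x : x \in u :: map snd p -> i <= lev x.
  rewrite inE => /orP[/eqP->|]; first exact: lowF e1F ue1.
  case/mapP=> -[e y] yp /= ->.
  elim: p u hp sF yp {up_ us e1p e2p a1p a2p w we2 ue1} => [|[f z] p IHp] v //=.
  move=> /andP[/andP[_ /= zf] hp] sF; rewrite inE => /predU1P[[_ ->]|yp].
    by apply: lowF zf; apply: sF; rewrite inE eqxx.
  apply: (IHp z) => //; first by rewrite (path_hop_start _ f).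
  by move=> e' ?; apply: sF; rewrite inE orbC; apply/orP; left.
have Fq e : e \in F -> e \notin map fst q.
  by move=> eF; apply/negP=> /lev_q; rewrite levF ?ltnn.
pose c := (e1, u) :: p ++ (e2, apex e2) :: q.
have -> : size p + size q + 2 = size c.
  by rewrite /c /= size_cat /= !addnS addn0.
apply: (@contains_closed_walk _ H c).
- by rewrite /c /= size_cat /= addnS !ltnS addn_gt0 q0 orbT.
- rewrite /c /= rcons_cat cat_path (path_hop_start _ set0) hp /= rcons_path.
  rewrite (path_hop_start _ set0) hq /hop !last_step lq /= ue1.
  by rewrite -/w we2 !(apex_in layers) ?FH.
- rewrite /c /= map_cat /= mem_cat inE !negb_or e1p e12 Fq // cat_uniq up_ /=.
  rewrite negb_or e2p Fq // uq !andbT /=.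
  by apply/hasPn=> e /lev_q; apply: contraTN => /sF/levF->; rewrite ltnn.
- rewrite /c [map _ _]/= map_cat -cat_cons cat_uniq us vq andbT /= negb_or a2p /=.
  apply/hasPn=> x /lvq/orP[|/eqP->//]; apply: contraTN => /lowp.
  by rewrite leqNgt.
- move=> e; rewrite /c /= map_cat inE mem_cat inE.
  by case/or4P=> [/eqP->|/sF/FH|/eqP->|/qH] //; apply: FH.
Qed.

(** Two bounds fix the constant [2 * k.+1]: a degree above [2 * k] leaves more
than [k] edges of one colour at each vertex, enough to avoid the at most
[k - 1] other vertices of the path, and the greedy path itself needs degree
above [k + 1]. *)
Lemma dense_level_berge_cycles H comp lev apex up i k :
  linear_hypergraph H -> {in H, forall e, 2 < #|e|} ->
  bfs_layering H comp lev apex up ->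
  2 * k.+1 * #|[set v | (lev v == i) || (lev v == i.+1)]|
    < #|[set e in H | lev (apex e) == i]| ->
  berge_cycles_consecutive k H.
Proof.
move=> lin card_gt2 layers dense.
pose E := [set e in H | lev (apex e) == i]; pose g e := e :\ apex e.
pose W0 := [set v | (lev v == i) || (lev v == i.+1)].
have EW0 : inside E g W0 = E.
  apply/setP=> e; rewrite inE andb_idr // inE => /andP[eH /eqP le].
  apply/subsetP=> v; rewrite !inE => /andP[_ ve].
  have := lev_edge layers eH (apex_in layers eH) ve.
  by have := apex_min layers eH ve; rewrite le; lia.
have [|W] := @minimal_dense_set _ _ E g W0 (2 * k.+1); first by rewrite EW0.
set F := inside E g W => -[[e0 e0F] deg conn].
have FP e : e \in F -> [/\ e \in H, lev (apex e) = i & g e \subset W].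
  by rewrite !inE -andbA => /and3P[-> /eqP-> ->].
clearbody F.
have FH : F \subset H by apply/subsetP=> e /FP[].
have linF : linear_hypergraph F.
  by move=> e f /FP[eH _ _] /FP[fH _ _]; apply: lin.
have levF : {in F, forall e, lev (apex e) = i} by move=> e /FP[].
have gsub : {in F, forall e, g e \subset e} by move=> e _; apply: subD1set.
have gW : {in F, forall e, g e \subset W} by move=> e /FP[].
have aF e : e \in F -> apex e \in e.
  by move=> /FP[eH _ _]; exact: (apex_in layers eH).
have g_gt1 : {in F, forall e, 1 < #|g e|}.
  move=> e eF; have [eH _ _] := FP e eF; have := card_gt2 e eH.
  by rewrite (cardsD1 (apex e)) aF.
have g_inh e : e \in F -> exists t, [/\ t \in g e, t \in e & t \in W].
  move=> eF; have /card_gt0P[t te] := ltnW (g_gt1 e eF).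
  by exists t; rewrite te (subsetP (gsub e eF)) // (subsetP (gW e eF)).
pose S := [set apex e | e in F].
have levS : {in S, forall v, lev v = i}.
  by move=> _ /imsetP[e eF ->]; apply: levF.
have compS : {in S &, forall u v, comp u = comp v}.
  move=> _ _ /imsetP[e eF ->] /imsetP[f fF ->].
  have [x [_ xe xW]] := g_inh e eF; have [y [_ yf yW]] := g_inh f fF.
  have [[eH _ _] [fH _ _]] := (FP e eF, FP f fF).
  rewrite (comp_edge layers eH (aF e eF) xe) (comp_edge layers fH (aF f fF) yf).
  suff /(conn (fun v => comp v == comp y))/(_ x y xW yW) :
      {in F, forall e, {in g e &,
        forall v v', (comp v == comp y) = (comp v' == comp y)}}.
    by rewrite eqxx => /eqP.
  move=> e' e'F v v' ve ve'; have [e'H _ _] := FP e' e'F.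
  have s := subsetP (gsub e' e'F).
  by rewrite (comp_edge layers e'H (s _ ve) (s _ ve')).
have S_gt1 : 1 < #|S|.
  have [t [_ _ tW]] := g_inh e0 e0F.
  have /card_gt1P[e [f [+ + ef]]] : 1 < #|[set e in F | t \in g e]|.
    by apply: ltn_trans (deg t tW); lia.
  rewrite !inE => /andP[eF /andP[ta te]] /andP[fF /andP[_ tf]].
  apply/card_gt1P; exists (apex e), (apex f); rewrite !imset_f //; split=> //.
  apply: contraNneq ef => Ea; apply/eqP.
  apply: (linear_edge_eq linF eF fF te (aF e eF) tf _ ta).
  by rewrite Ea aF.
have [chi [d [d0 [a [b [aS bS chi_ab]]] below]]] :=
  bichromatic_below_paths layers levS compS S_gt1.
pose D u (c : bool) := [set e in F | (u \in g e) && (chi (apex e) == c)].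
have big_colour u : u \in W -> exists c, k < #|D u c|.
  move=> /deg degu.
  have : #|[set e in F | u \in g e]| <= #|D u true| + #|D u false|.
    apply: leq_trans (leq_of_leqif (leq_card_setU _ _)); apply: subset_leq_card.
    apply/subsetP=> e; rewrite !inE => /andP[-> ->].
    by case: (chi _).
  by have [|] := leqP #|D u true| k; [exists false; lia | exists true].
(* If every vertex of W saw one colour only, that colour would be constant on
   the connected set W, hence the same for all edges. *)
have [u uW two] : exists2 u, u \in W & forall c, exists e, e \in D u c.
  pose P t := [exists e in F, (t \in g e) && chi (apex e)].
  have [/existsP[u /and3P[uW /exists_inP[e eD _] /exists_inP[f fD _]]]|mono] :=
      boolP [exists u, [&& u \in W, [exists e in D u true, true]
                          & [exists f in D u false, true]]].
    by exists u => // -[]; [exists e; exact: eD | exists f; exact: fD].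
  have PE e t : e \in F -> t \in g e -> P t = chi (apex e).
    move=> eF te; apply/exists_inP/idP => [[f fF /andP[tf chif]]|chie]; last first.
      by exists e; rewrite ?te.
    apply: contraNT mono => chie; apply/existsP; exists t.
    rewrite (subsetP (gW e eF)) //=; apply/andP; split; apply/exists_inP.
      by exists f => //; rewrite in_set fF tf chif.
    by exists e => //; rewrite in_set eF te (negPf chie).
  have Pconst : {in F, forall e, {in g e &, forall x y, P x = P y}}.
    by move=> e eF x y xe ye; rewrite !(PE e).
  case/imsetP: aS chi_ab => e eF ->; case/imsetP: bS => f fF ->.
  have [x [xe _ xW]] := g_inh e eF; have [y [yf _ yW]] := g_inh f fF.
  by rewrite -(PE e x) // -(PE f y) // (conn P Pconst x y) ?eqxx.
have [c big_c] := big_colour u uW.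
(* f and its apex are set aside, to be used at u in case w has majority
   colour c as well. *)
have [f] := two (~~ c); rewrite in_set => /and3P[fF uf /eqP chif].
have gP e t : t \in g e -> t != apex e by rewrite !inE => /andP[].
exists (d + 2) => l /andP[dl ldk]; pose m := l - (d + 2).
have ltmk : m < k by rewrite ltn_subLR.
have degk : {in W, forall t, k.+1 < #|[set e in F | t \in g e]|}.
  by move=> t /deg; apply: leq_ltn_trans; rewrite leq_pmull.
have [p [sp bp pW fp ap]] :=
  greedy_berge_path linF gsub gW g_gt1 degk f uW (gP _ _ uf) (ltnW ltmk).
pose w := last u (map snd p); pose P := u :: map snd p.
have wP : w \in P by exact: mem_last.
have pick_end t col : t \in P -> k < #|D t col| -> exists e,
    [/\ e \in F, t \in e, chi (apex e) = col, e \notin map fst p & apex e \notin P].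
  move=> tP big; pose X := [set x in P] :\ t.
  have DF : D t col \subset F by apply/subsetP=> e; rewrite inE => /andP[].
  have tD : {in D t col, forall e, t \in e}.
    by move=> e; rewrite in_set => /and3P[eF te _]; apply: subsetP (gsub e eF) _ te.
  have tX : t \notin X by rewrite !inE eqxx.
  have cX : #|X| < #|D t col|.
    apply: leq_ltn_trans big; case: (bp) => _ _ /card_uniqP cP _.
    move: (cardsD1 t [set x in P]); rewrite inE tP cardsE cP /= size_map sp -/X.
    by rewrite add1n => -[<-]; exact: ltnW.
  have [e + eX] := exists_edge_avoiding linF DF tD tX cX.
  rewrite in_set => /and3P[eF te /eqP chie]; exists e; split=> //.
  - exact: subsetP (gsub e eF) _ te.
  - apply/negP=> /(berge_path_edge t bp)[x [xe xP xt]].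
    by have := disjointFr eX xe; rewrite in_setD1 xt inE xP.
  - apply/negP=> aP; have := disjointFr eX (aF e eF).
    by rewrite in_setD1 eq_sym gP // inE aP.
have [e1 [e2 [[e1F ue1 e1p a1p] [e2F we2 e2p a2p] chi12]]] : exists e1 e2,
    [/\ [/\ e1 \in F, u \in e1, e1 \notin map fst p & apex e1 \notin P],
        [/\ e2 \in F, w \in e2, e2 \notin map fst p & apex e2 \notin P]
      & chi (apex e2) != chi (apex e1)].
  have [col big_w] := big_colour w (pW _ wP).
  have [e2 [e2F we2 chi2 e2p a2p]] := pick_end w col wP big_w.
  have [Ecol|Ncol] := eqVneq col c.
    exists f, e2; split=> //; last by rewrite chi2 chif Ecol; case: (c).
    split=> //; first exact: subsetP (gsub f fF) _ uf.
    by rewrite inE negb_or ap andbT eq_sym gP.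
  have [e1 [e1F ue1 chi1 e1p a1p]] := pick_end u c (mem_head _ _) big_c.
  by exists e1, e2; split=> //; rewrite chi2 chi1.
have e12 : e1 != e2 by apply: contraNneq chi12 => ->.
have [q sq bq] := below _ _ (imset_f _ e2F) (imset_f _ e1F) chi12.
have -> : l = size p + size q + 2 by rewrite sp sq -addnA subnK.
by apply: (close_berge_cycle layers FH levF bp e1F e2F e12); rewrite ?sq.
Qed.

Lemma sum_degree H : \sum_(v : V) degree H v = \sum_(e in H) #|e|.
Proof.
rewrite /degree; under eq_bigr do rewrite -sum1dep_card big_mkcondr.
rewrite exchange_big; apply: eq_bigr => e eH.
by rewrite -big_mkcond sum1_card.
Qed.

End Main.

Theorem theorem1p4 (r k : nat) (V : finType) (H : {set {set V}})
  (hr : 3 <= r) (hk : 1 <= k) (hV : 0 < #|V|)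
  (hunif : uniform r H) (hlin : linear_hypergraph H)
  (hdeg : ((7 * r * (k + 1))%:R <= avg_degree H)%R) :
  berge_cycles_consecutive k H.
Proof.
have [x0 _] := card_gt0P hV.
have cardH : 7 * (k + 1) * #|V| <= #|H|.
  have : 7 * r * (k + 1) * #|V| <= r * #|H|.
    move: hdeg; rewrite /avg_degree Num.Theory.ler_pdivlMr; last first.
      by rewrite Num.Theory.ltr0n.
    rewrite -GRing.natrM Num.Theory.ler_nat.
    rewrite sum_degree (eq_bigr (fun=> r)) => [|e /hunif->//].
    by rewrite sum_nat_const mulnC [r * _]mulnC.
  have -> : 7 * r * (k + 1) * #|V| = r * (7 * (k + 1) * #|V|) by lia.
  by rewrite leq_pmul2l //; lia.
have [|comp [lev [apex [up layers]]]] := @bfs_layering_exists V H x0.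
  by move=> e eH; rewrite -card_gt0 (hunif e eH); lia.
have [|i dense] := @bfs_dense_level _ _ _ _ _ _ (2 * k.+1) layers.
  by apply: leq_trans cardH; nia.
apply: dense_level_berge_cycles hlin _ layers dense.
by move=> e eH; rewrite (hunif e eH).
Qed.
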